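(* Let $\mathcal I=((H_n)_{n\in\mathbb N_0},a^* )$ be an interacting Fock space based on a pre-Hilbert space $H$. Then: 1. For $x\in H$, $a^*(x)$ is bounded if and only if there exists a constant $M_x$ such that $\|\Lambda\ell^*(x)X\|\le M_x\|\Lambda X\|$ for all $X\in\mathscr F(H)$. 2. The creator map $a^*$ is bounded if and only if there exists a constant $M$ such that $\|\Lambda\ell^*(x)X\|\le M\|x\|\,\|\Lambda X\|$ for all $x\in H$ and $X\in\mathscr F(H)$.
   Context: All vector spaces are complex; direct sums and tensor products of pre-Hilbert spaces are algebraic; $\mathscr L(V)$ is the space of all linear maps $V\to V$. $\mathscr F(H)=\Omega\mathbb C\oplus\bigoplus_{n\ge1}H^{\otimes n}$ is the algebraic full Fock space over $H$ with natural inner product; $\ell^*(x)\colon X\mapsto x\otimes X$ (with $\ell^*(x)\Omega=x$). An interacting Fock space based on $H$ consists of pre-Hilbert spaces $H_n$ with $H_0=\Omega\mathbb C$ ($\Omega$ a unit vector), $\mathcal I=\bigoplus_nH_n$, and a linear map (the creator map) $a^*\colon H\to\mathscr L(\mathcal I)$ with $\operatorname{span}a^*(H)H_n=H_{n+1}$ for all $n$. $\Lambda\colon\mathscr F(H)\to\mathcal I$ is the linear map with $\Lambda\Omega=\Omega$, $\Lambda(x_n\otimes\dots\otimes x_1)=a^*(x_n)\cdots a^*(x_1)\Omega$. The creator map is bounded if all $a^*(x)$ are bounded and $x\mapsto a^*(x)$ is bounded for the operator norm. *)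

(* Defs.v *)
From HB Require Import structures.
From mathcomp Require Import all_boot all_order all_algebra sesquilinear.
From mathcomp Require Import complex generic_quotient.
From mathcomp Require Import all_classical reals.

Set Implicit Arguments.
Unset Strict Implicit.
Unset Printing Implicit Defensive.

Import Order.TTheory GRing.Theory Num.Theory Num.Def.

Local Open Scope classical_set_scope.
Local Open Scope ring_scope.

HB.mixin Record isPreHilbert (C : numClosedFieldType) V of GRing.Lmodule C V := {
  hdot : {dot V for (@conjC C)}
}.

(* As everywhere in sesquilinear.v, the inner product is linear in its first
   argument and conjugate-linear in the second one. *)
#[short(type="preHilbertType")]
HB.structure Definition PreHilbert (C : numClosedFieldType) :=
  { V of isPreHilbert C V & GRing.Lmodule C V }.

Notation "''[' u , v ]" := (hdot u v) : ring_scope.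

Section DotOf.
Variables (C : numClosedFieldType) (V : lmodType C) (f : V -> V -> C).
Hypothesis f_lin : forall a x y z, f (a *: x + y) z = a * f x z + f y z.
Hypothesis f_conj : forall x y, f x y = (f y x)^*.
Hypothesis f_pos : forall x, x != 0 -> 0 < f x x.

Let f_bilinear : bilinear_for
  (GRing.Scale.Law.clone _ _ *%R _) (GRing.Scale.Law.clone _ _ (conjC \; *%R) _) f.
Proof.
split=> [z a x y|z a x y] /=; first exact: f_lin.
by rewrite f_conj f_lin rmorphD rmorphM /= [f z x]f_conj [f z y]f_conj.
Qed.

Let f_herm x y : f x y = (-1) ^+ false * (f y x)^*.
Proof. by rewrite mul1r. Qed.

Definition dot_of : {dot V for (@conjC C)} :=
  HB.pack_for {dot V for (@conjC C)} f
    (bilinear_isBilinear.Build _ _ _ _ _ _ f f_bilinear)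
    (isHermitianSesquilinear.Build _ _ _ _ f f_herm)
    (isDotProduct.Build _ _ f f_pos).

Lemma dot_ofE x y : dot_of x y = f x y. Proof. by []. Qed.

End DotOf.

Section Scalars.
Variable C : numClosedFieldType.

Let sdot (x y : C^o) : C := (x : C) * (y : C)^*.

Let sdot_lin a (x y z : C^o) : sdot (a *: x + y) z = a * sdot x z + sdot y z.
Proof. by rewrite /sdot mulrDl -mulrA. Qed.

Let sdot_conj (x y : C^o) : sdot x y = (sdot y x)^*.
Proof. by rewrite /sdot rmorphM /= conjCK mulrC. Qed.

Let sdot_pos (x : C^o) : x != 0 -> 0 < sdot x x.
Proof. by move=> x0; rewrite /sdot -normCK exprn_gt0 ?normr_gt0. Qed.

HB.instance Definition _ :=
  isPreHilbert.Build C C^o (dot_of sdot_lin sdot_conj sdot_pos).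

Lemma sdotE (x y : C^o) : '[x, y] = (x : C) * (y : C)^*.
Proof. by []. Qed.

End Scalars.

Section DirectSum.
Variables (C : numClosedFieldType) (V : nat -> preHilbertType C).

Definition finsupp (f : forall n, V n) :=
  exists N, forall n, (N <= n)%N -> f n = 0.

Record dsum := DSum {
  dsum_fun :> forall n, V n;
  dsum_finsupp : `[< finsupp dsum_fun >]
}.

HB.instance Definition _ := [isSub for dsum_fun].
HB.instance Definition _ := [Choice of dsum by <:].

Lemma dsumP (X Y : dsum) : (forall n, X n = Y n) -> X = Y.
Proof. by move=> XY; apply: val_inj; apply: functional_extensionality_dep. Qed.

Lemma dsum_bound (X : dsum) : exists N, forall n, (N <= n)%N -> X n = 0.
Proof. by case: X => f /= /asboolP. Qed.

Let zero_fin : `[< finsupp (fun=> 0) >].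
Proof. by apply/asboolP; exists 0%N. Qed.
Let add_fin (X Y : dsum) : `[< finsupp (fun n => X n + Y n) >].
Proof.
apply/asboolP; have [N XN] := dsum_bound X; have [M YM] := dsum_bound Y.
exists (maxn N M) => n; rewrite geq_max => /andP[Nn Mn].
by rewrite XN // YM // addr0.
Qed.
Let opp_fin (X : dsum) : `[< finsupp (fun n => - X n) >].
Proof.
by apply/asboolP; have [N XN] := dsum_bound X; exists N => n /XN->; rewrite oppr0.
Qed.
Let scale_fin c (X : dsum) : `[< finsupp (fun n => c *: X n) >].
Proof.
by apply/asboolP; have [N XN] := dsum_bound X; exists N => n /XN->; rewrite scaler0.
Qed.

Let addA : associative (fun X Y => DSum (add_fin X Y)).
Proof. by move=> X Y Z; apply: dsumP => n /=; rewrite addrA. Qed.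
Let addC : commutative (fun X Y => DSum (add_fin X Y)).
Proof. by move=> X Y; apply: dsumP => n /=; rewrite addrC. Qed.
Let add0 : left_id (DSum zero_fin) (fun X Y => DSum (add_fin X Y)).
Proof. by move=> X; apply: dsumP => n /=; rewrite add0r. Qed.
Let addN : left_inverse (DSum zero_fin) (fun X => DSum (opp_fin X))
             (fun X Y => DSum (add_fin X Y)).
Proof. by move=> X; apply: dsumP => n /=; rewrite addNr. Qed.
HB.instance Definition _ := GRing.isZmodule.Build dsum addA addC add0 addN.

Lemma dsum0E n : (0 : dsum) n = 0. Proof. by []. Qed.
Lemma dsumDE (X Y : dsum) n : (X + Y) n = X n + Y n. Proof. by []. Qed.

Let scaleA a b (X : dsum) :
  DSum (scale_fin a (DSum (scale_fin b X))) = DSum (scale_fin (a * b) X).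
Proof. by apply: dsumP => n /=; rewrite scalerA. Qed.
Let scale1 : left_id 1 (fun c X => DSum (scale_fin c X)).
Proof. by move=> X; apply: dsumP => n /=; rewrite scale1r. Qed.
Let scaleDr : right_distributive (fun c X => DSum (scale_fin c X)) +%R.
Proof. by move=> c X Y; apply: dsumP => n /=; rewrite scalerDr. Qed.
Let scaleDl (X : dsum) :
  {morph (fun c => DSum (scale_fin c X)) : a b / a + b}.
Proof. by move=> a b; apply: dsumP => n /=; rewrite scalerDl. Qed.
HB.instance Definition _ :=
  GRing.Zmodule_isLmodule.Build C dsum scaleA scale1 scaleDr scaleDl.

Lemma dsumZE c (X : dsum) n : (c *: X) n = c *: X n. Proof. by []. Qed.

Let ddot (X Y : dsum) : C := \sum_(n \in setT) '[X n, Y n].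

Lemma fsum_ord (W : nmodType) (F : nat -> W) N :
  (forall n, (N <= n)%N -> F n = 0) ->
  \sum_(n \in setT) F n = \sum_(n < N) F n.
Proof.
move=> FN; rewrite fsbig_ord; apply/esym/fsbig_widen => // n /= [_ nN].
by apply: FN; rewrite leqNgt; apply/negP.
Qed.

Let ddot_bound (X Y : dsum) N : (forall n, (N <= n)%N -> X n = 0) ->
  ddot X Y = \sum_(n < N) '[X n, Y n].
Proof. by move=> XN; apply: fsum_ord => n /XN->; rewrite linear0l. Qed.

Let ddot_lin a X Y Z : ddot (a *: X + Y) Z = a * ddot X Z + ddot Y Z.
Proof.
have [N XN] := dsum_bound X; have [M YM] := dsum_bound Y.
have XK n : (maxn N M <= n)%N -> X n = 0.
  by rewrite geq_max => /andP[/XN].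
have YK n : (maxn N M <= n)%N -> Y n = 0.
  by rewrite geq_max => /andP[_ /YM].
rewrite (ddot_bound _ XK) (ddot_bound _ YK) (@ddot_bound _ _ (maxn N M)).
  rewrite mulr_sumr -big_split; apply: eq_bigr => n _ /=.
  by rewrite linearPl.
by move=> n nK; rewrite dsumDE dsumZE XK // YK // scaler0 addr0.
Qed.

Let ddot_conj X Y : ddot X Y = (ddot Y X)^*.
Proof.
have [N XN] := dsum_bound X.
rewrite (ddot_bound _ XN) /ddot (@fsum_ord _ _ N).
  by rewrite rmorph_sum; apply: eq_bigr => n _; rewrite hermC mul1r.
by move=> n /XN->; rewrite linear0r.
Qed.

Let ddot_pos X : X != 0 -> 0 < ddot X X.
Proof.
move=> X0; have [N XN] := dsum_bound X; rewrite (ddot_bound _ XN).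
rewrite lt_def sumr_ge0 ?andbT => [|n _]; last exact: dnorm_ge0.
apply: contra X0; rewrite psumr_eq0 => [|n _]; last exact: dnorm_ge0.
move=> /allP XE; apply/eqP/dsumP => n; rewrite dsum0E.
have [nN|/XN//] := ltnP n N.
have := XE (Ordinal nN); rewrite mem_index_enum => /(_ isT) /=.
by rewrite dnorm_eq0 => /eqP.
Qed.

HB.instance Definition _ :=
  isPreHilbert.Build C dsum (dot_of ddot_lin ddot_conj ddot_pos).

Lemma dsum_dotE (X Y : dsum) : '[X, Y] = \sum_(n \in setT) '[X n, Y n].
Proof. by []. Qed.

Let inj_fin n (v : V n) : `[< finsupp (dfwith (T := fun m => V m) (fun m => 0) n v) >].
Proof.
apply/asboolP; exists n.+1 => m nm; rewrite dfwithout //.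
by apply: contraTneq nm => ->; rewrite ltnn.
Qed.

Definition dsum_in n (v : V n) : dsum := DSum (inj_fin v).

End DirectSum.

Section Tensor.
Variables (C : numClosedFieldType) (U V : preHilbertType C).

(* A list of pairs (u_i, v_i) stands for the tensor \sum_i u_i \otimes v_i.
   [teq] is the congruence generated by the bilinearity relations on these
   formal sums, for the addition given by concatenation up to permutation. *)
Inductive teq : seq (U * V) -> seq (U * V) -> Prop :=
| teq_refl s : teq s s
| teq_sym s t : teq s t -> teq t s
| teq_trans s t r : teq s t -> teq t r -> teq s r
| teq_catC s t : teq (s ++ t) (t ++ s)
| teq_cat s s' t : teq s s' -> teq (s ++ t) (s' ++ t)
| teq_addl u u' v : teq [:: (u + u', v)] [:: (u, v); (u', v)]
| teq_addr u v v' : teq [:: (u, v + v')] [:: (u, v); (u, v')]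
| teq_scale c u v : teq [:: (c *: u, v)] [:: (u, c *: v)]
| teq_zero v : teq [:: (0, v)] [::].

Let teqb s t := `[< teq s t >].

Let teqb_equiv : equiv_class_of teqb.
Proof.
split=> [s|s t|t s r]; first by apply/asboolP; apply: teq_refl.
  by apply/idP/idP => /asboolP st; apply/asboolP; apply: teq_sym.
by move=> /asboolP st /asboolP tr; apply/asboolP; apply: teq_trans st tr.
Qed.

Canonical teq_equiv := EquivRelPack teqb_equiv.
Canonical teq_encModRel := defaultEncModRel teqb.

Definition tens := {eq_quot teqb}%qT.
HB.instance Definition _ : EqQuotient _ teqb tens := EqQuotient.on tens.
HB.instance Definition _ := Choice.on tens.

Let cls (s : seq (U * V)) : tens := (\pi_tens s)%qT.

Let clsP s t : teq s t <-> cls s = cls t.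
Proof.
split=> [st|/eqmodP/asboolP//].
by apply/eqmodP/asboolP.
Qed.

Let reprP s : teq (repr (cls s)) s.
Proof. by apply/clsP; rewrite /cls reprK. Qed.

Let clsE (X : tens) : exists s, X = cls s.
Proof. by exists (repr X); rewrite /cls reprK. Qed.

Let teq_cat2 s s' t t' : teq s s' -> teq t t' -> teq (s ++ t) (s' ++ t').
Proof.
move=> ss' tt'; apply: teq_trans (teq_cat _ ss') _.
apply: teq_trans (teq_catC _ _) _; apply: teq_trans (teq_catC _ _).
exact: teq_cat.
Qed.

Let tscale (c : C) (s : seq (U * V)) := [seq (c *: p.1, p.2) | p <- s].

Let tscale_cat c s t : tscale c (s ++ t) = tscale c s ++ tscale c t.
Proof. exact: map_cat. Qed.

Let teq_tscale c s t : teq s t -> teq (tscale c s) (tscale c t).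
Proof.
elim=> {s t} [s|s t _|s t r _ st _ tr|s t|s s' t _ IH|u u' v|u v v'|d u v|v] /=.
- exact: teq_refl.
- exact: teq_sym.
- exact: teq_trans st tr.
- by rewrite !tscale_cat; apply: teq_catC.
- by rewrite !tscale_cat; apply: teq_cat.
- by rewrite scalerDr; apply: teq_addl.
- exact: teq_addr.
- by rewrite scalerA mulrC -scalerA; apply: teq_scale.
- by rewrite scaler0; apply: teq_zero.
Qed.

Let tadd (X Y : tens) : tens := cls (repr X ++ repr Y).
Let tmul c (X : tens) : tens := cls (tscale c (repr X)).

Let taddE s t : tadd (cls s) (cls t) = cls (s ++ t).
Proof. by apply/clsP; apply: teq_cat2; apply: reprP. Qed.
Let tmulE c s : tmul c (cls s) = cls (tscale c s).
Proof. by apply/clsP; apply: teq_tscale; apply: reprP. Qed.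

Let taddA : associative tadd.
Proof.
move=> X Y Z; have [s ->] := clsE X; have [t ->] := clsE Y.
by have [r ->] := clsE Z; rewrite !taddE catA.
Qed.
Let taddC : commutative tadd.
Proof.
move=> X Y; have [s ->] := clsE X; have [t ->] := clsE Y.
by rewrite !taddE; apply/clsP; apply: teq_catC.
Qed.
Let tadd0 : left_id (cls [::]) tadd.
Proof. by move=> X; have [s ->] := clsE X; rewrite taddE. Qed.

Let tscaleDl a b s : teq (tscale (a + b) s) (tscale a s ++ tscale b s).
Proof.
elim: s => [|[u v] s IH] /=; first exact: teq_refl.
rewrite scalerDl -cat1s.
apply: teq_trans (teq_cat2 (teq_addl _ _ _) IH) _.
rewrite -[X in teq X]/([:: (a *: u, v)] ++
  ([:: (b *: u, v)] ++ (tscale a s ++ tscale b s))).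
rewrite -[X in teq _ X]/([:: (a *: u, v)] ++
  (tscale a s ++ ([:: (b *: u, v)] ++ tscale b s))).
apply: teq_cat2 (teq_refl _) _; rewrite !catA.
by apply: teq_cat; apply: teq_catC.
Qed.

Let tscale0 s : teq (tscale 0 s) [::].
Proof.
elim: s => [|[u v] s IH] /=; first exact: teq_refl.
rewrite scale0r -cat1s; exact: teq_cat2 (teq_zero _) IH.
Qed.

Let tscale1 s : tscale 1 s = s.
Proof. by elim: s => [|[u v] s IH] //=; rewrite scale1r IH. Qed.

Let taddN : left_inverse (cls [::]) (tmul (-1)) tadd.
Proof.
move=> X; have [s ->] := clsE X; rewrite tmulE taddE.
apply/clsP; rewrite -{2}(tscale1 s); apply: teq_trans (teq_sym (tscaleDl _ _ _)) _.
by rewrite addNr; apply: tscale0.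
Qed.
HB.instance Definition _ := GRing.isZmodule.Build tens taddA taddC tadd0 taddN.

Let clsD s t : cls (s ++ t) = cls s + cls t.
Proof. by rewrite -taddE. Qed.

Let tmulA a b X : tmul a (tmul b X) = tmul (a * b) X.
Proof.
have [s ->] := clsE X; rewrite !tmulE /tscale -map_comp.
by congr cls; apply: eq_map => p /=; rewrite scalerA.
Qed.
Let tmul1 : left_id 1 tmul.
Proof. by move=> X; have [s ->] := clsE X; rewrite tmulE tscale1. Qed.
Let tmulDr : right_distributive tmul +%R.
Proof.
move=> c X Y; have [s ->] := clsE X; have [t ->] := clsE Y.
by rewrite -clsD !tmulE tscale_cat clsD.
Qed.
Let tmulDl (X : tens) : {morph tmul^~ X : a b / a + b}.
Proof.
move=> a b; have [s ->] := clsE X; rewrite !tmulE.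
by rewrite -clsD; apply/clsP; apply: tscaleDl.
Qed.
HB.instance Definition _ :=
  GRing.Zmodule_isLmodule.Build C tens tmulA tmul1 tmulDr tmulDl.

Definition tpure (u : U) (v : V) : tens := cls [:: (u, v)].

Let clsZ c s : cls (tscale c s) = c *: cls s.
Proof. by rewrite -tmulE. Qed.

Lemma tpureDl u u' v : tpure (u + u') v = tpure u v + tpure u' v.
Proof. by rewrite -clsD; apply/clsP; apply: teq_addl. Qed.
Lemma tpureDr u v v' : tpure u (v + v') = tpure u v + tpure u v'.
Proof. by rewrite -clsD; apply/clsP; apply: teq_addr. Qed.
Lemma tpureZl c u v : tpure (c *: u) v = c *: tpure u v.
Proof. by rewrite -clsZ. Qed.
Lemma tpureZr c u v : tpure u (c *: v) = c *: tpure u v.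
Proof. by rewrite -tpureZl; apply/esym/clsP; apply: teq_scale. Qed.

Let cls_sum s : cls s = \sum_(p <- s) tpure p.1 p.2.
Proof.
elim: s => [|[u v] s IH]; first by rewrite big_nil.
by rewrite -cat1s clsD big_cat big_seq1 IH.
Qed.

Lemma tens_sum (X : tens) : X = \sum_(p <- repr X) tpure p.1 p.2.
Proof. by rewrite -cls_sum /cls reprK. Qed.

(* The linear map on the tensor product induced by [b], if [b] is bilinear
   (see [tens_liftE] and [tens_lift_linear]); arbitrary otherwise. *)
Definition tens_lift (W : lmodType C) (b : U -> V -> W) (X : tens) : W :=
  \sum_(p <- repr X) b p.1 p.2.

Section Lift.
Variables (W : zmodType) (b : U -> V -> W).
Hypothesis bDl : forall u u' v, b (u + u') v = b u v + b u' v.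
Hypothesis bDr : forall u v v', b u (v + v') = b u v + b u v'.
Hypothesis bZ : forall c u v, b (c *: u) v = b u (c *: v).

Let pre (s : seq (U * V)) := \sum_(p <- s) b p.1 p.2.

Let pre_teq s t : teq s t -> pre s = pre t.
Proof.
rewrite /pre; elim=> {s t} [//|//|s t r _ -> _ ->|s t|s s' t _ IH|u u' v|u v v'|d u v|v] //=.
- by rewrite !big_cat /= addrC.
- by rewrite !big_cat /= IH.
- by rewrite big_seq1 big_cons big_seq1 /= bDl.
- by rewrite big_seq1 big_cons big_seq1 /= bDr.
- by rewrite !big_seq1 /= bZ.
- rewrite big_seq1 big_nil /=; apply: (addIr (b 0 v)).
  by rewrite -bDl addr0 add0r.
Qed.

Lemma tens_sum_repr s : \sum_(p <- repr (cls s)) b p.1 p.2 = \sum_(p <- s) b p.1 p.2.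
Proof. exact: pre_teq (reprP s). Qed.

End Lift.

Section LiftLinear.
Variables (W : lmodType C) (b : U -> V -> W).
Hypothesis bl : forall v c x y, b (c *: x + y) v = c *: b x v + b y v.
Hypothesis br : forall u c x y, b u (c *: x + y) = c *: b u x + b u y.

Let bDl u u' v : b (u + u') v = b u v + b u' v.
Proof. by rewrite -[u in LHS]scale1r bl scale1r. Qed.
Let bDr u v v' : b u (v + v') = b u v + b u v'.
Proof. by rewrite -[v in LHS]scale1r br scale1r. Qed.
Let b0l v : b 0 v = 0.
Proof. by apply: (addIr (b 0 v)); rewrite -bDl addr0 add0r. Qed.
Let b0r u : b u 0 = 0.
Proof. by apply: (addIr (b u 0)); rewrite -bDr addr0 add0r. Qed.
Let bZl c u v : b (c *: u) v = c *: b u v.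
Proof. by rewrite -[c *: u]addr0 bl b0l addr0. Qed.
Let bZr c u v : b u (c *: v) = c *: b u v.
Proof. by rewrite -[c *: v]addr0 br b0r addr0. Qed.
Let bZ c u v : b (c *: u) v = b u (c *: v).
Proof. by rewrite bZl bZr. Qed.

Lemma tens_liftE u v : tens_lift b (tpure u v) = b u v.
Proof. by rewrite /tens_lift (tens_sum_repr bDl bDr bZ) big_seq1. Qed.

Lemma tens_lift_linear c X Y :
  tens_lift b (c *: X + Y) = c *: tens_lift b X + tens_lift b Y.
Proof.
have [s ->] := clsE X; have [t ->] := clsE Y.
rewrite -clsZ -clsD /tens_lift !(tens_sum_repr bDl bDr bZ) big_cat big_map.
by rewrite scaler_sumr; congr (_ + _); apply: eq_bigr => p _ /=; rewrite bZl.
Qed.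

End LiftLinear.

Let tdot (X Y : tens) : C :=
  \sum_(p <- repr X) \sum_(q <- repr Y) '[p.1, q.1] * '[p.2, q.2].

Let tdotE s t : tdot (cls s) (cls t) =
  \sum_(p <- s) \sum_(q <- t) '[p.1, q.1] * '[p.2, q.2].
Proof.
rewrite /tdot (tens_sum_repr (W := C)
  (b := fun u v => \sum_(q <- repr (cls t)) '[u, q.1] * '[v, q.2])).
- apply: eq_bigr => p _.
  rewrite (tens_sum_repr (W := C) (b := fun u v => '[p.1, u] * '[p.2, v])) //.
  + by move=> u u' v; rewrite linearDr mulrDl.
  + by move=> u v v'; rewrite linearDr mulrDr.
  + by move=> c u v; rewrite !linearZr_LR /= mulrCA mulrA.
- move=> u u' v; rewrite -big_split; apply: eq_bigr => q _.
  by rewrite linearDl mulrDl.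
- move=> u v v'; rewrite -big_split; apply: eq_bigr => q _.
  by rewrite linearDl mulrDr.
- by move=> c u v; apply: eq_bigr => q _; rewrite !linearZl_LR /= mulrCA mulrA.
Qed.

Let tdot_lin a X Y Z : tdot (a *: X + Y) Z = a * tdot X Z + tdot Y Z.
Proof.
have [s ->] := clsE X; have [t ->] := clsE Y; have [r ->] := clsE Z.
rewrite -clsZ -clsD !tdotE big_cat big_map mulr_sumr; congr (_ + _).
apply: eq_bigr => p _; rewrite mulr_sumr; apply: eq_bigr => q _.
by rewrite linearZl_LR /= mulrA.
Qed.

Let tdot_conj X Y : tdot X Y = (tdot Y X)^*.
Proof.
rewrite /tdot exchange_big rmorph_sum; apply: eq_bigr => q _.
rewrite rmorph_sum; apply: eq_bigr => p _; rewrite rmorphM.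
by rewrite [in LHS]hermC [X in _ * X = _]hermC !mul1r.
Qed.

Let tens_ortho (X : tens) : exists vs (c : V -> U),
  pairwise_orthogonal (@hdot C V) vs /\ X = \sum_(w <- vs) tpure (c w) w.
Proof.
have [s ->] := clsE X; elim: s => [|[u v] s [vs [c [ovs IH]]]].
  by exists [::], (fun=> 0); rewrite big_nil.
pose k w := '[v, w] / '[w, w].
pose r := v - \sum_(w <- vs) k w *: w.
have vE : v = r + \sum_(w <- vs) k w *: w by rewrite subrK.
have [/= /andP[vs0 uvs] ovs'] := pairwise_orthogonalP ovs.
have rvs w : w \in vs -> '[r, w] = 0.
  move=> wvs; rewrite linearBl linear_sumlz (bigD1_seq w) //=.
  rewrite big_seq_cond big1 => [|w' /andP[w'vs nw]].
    rewrite linearZl_LR /= divfK ?addr0 ?subrr // dnorm_eq0.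
    by apply: contraNneq vs0 => <-.
  by rewrite linearZl_LR /= ovs' // mulr0.
have sE : cls ((u, v) :: s) =
    tpure u r + \sum_(w <- vs) tpure (c w + k w *: u) w.
  rewrite -cat1s clsD IH -[cls [:: _]]/(tpure u v) {1}vE tpureDr -addrA.
  congr (_ + _); have -> : tpure u (\sum_(w <- vs) k w *: w) =
      \sum_(w <- vs) tpure (k w *: u) w.
    elim: (vs) => [|w t IHt]; last by rewrite !big_cons tpureDr IHt tpureZr tpureZl.
    rewrite !big_nil; apply: (addIr (tpure u 0)).
    by rewrite -tpureDr addr0 add0r.
  by rewrite -big_split; apply: eq_bigr => w _; rewrite /= tpureDl addrC.
have [r0|r0] := eqVneq r 0.
  exists vs, (fun w => c w + k w *: u); split => //.
  rewrite sE r0; have -> : tpure u 0 = 0; last by rewrite add0r.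
  by apply: (addIr (tpure u 0)); rewrite -tpureDr addr0 add0r.
have rNvs : r \notin vs.
  by apply: contra r0 => /rvs /eqP; rewrite dnorm_eq0.
exists (r :: vs), (fun w => if w == r then u else c w + k w *: u); split.
  apply/pairwise_orthogonalP; split.
    by rewrite /= inE negb_or eq_sym r0 vs0 rNvs.
  move=> p q; rewrite !inE => /predU1P[->|pvs] /predU1P[->|qvs] pq.
  - by rewrite eqxx in pq.
  - exact: rvs.
  - by apply/eqP; rewrite herm_eq0C; apply/eqP; apply: rvs.
  - exact: ovs'.
rewrite sE big_cons eqxx; congr (_ + _); apply: eq_big_seq => w wvs.
by case: eqP => // wr; rewrite -wr wvs in rNvs.
Qed.

Let tdot_pos X : X != 0 -> 0 < tdot X X.
Proof.
have [vs [c [ovs XE]]] := tens_ortho X.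
have XcE : X = cls [seq (c w, w) | w <- vs] by rewrite cls_sum big_map.
have [/= /andP[vs0 uvs] ovs'] := pairwise_orthogonalP ovs.
have -> : tdot X X = \sum_(w <- vs) '[c w, c w] * '[w, w].
  rewrite XcE tdotE big_map; apply: eq_big_seq => w wvs.
  rewrite big_map (bigD1_seq w) //= big_seq_cond big1 ?addr0 // => w' /andP[w'vs nw].
  by rewrite ovs' ?mulr0 // eq_sym.
move=> X0; rewrite lt_def sumr_ge0 ?andbT => [|w _]; last first.
  by apply: mulr_ge0; apply: dnorm_ge0.
apply: contra X0; rewrite psumr_eq0 => [|w _]; last first.
  by apply: mulr_ge0; apply: dnorm_ge0.
move=> /allP c0; rewrite XE big_seq big1 // => w wvs.
have := c0 _ wvs; rewrite /= mulf_eq0 !dnorm_eq0 => /orP[/eqP->|/eqP w0].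
  by apply: (addIr (tpure 0 w)); rewrite -tpureDl addr0 add0r.
by rewrite -w0 wvs in vs0.
Qed.

HB.instance Definition _ :=
  isPreHilbert.Build C tens (dot_of tdot_lin tdot_conj tdot_pos).

Lemma tpure_dotE u v u' v' :
  '[tpure u v, tpure u' v'] = '[u, u'] * '[v, v'].
Proof. by rewrite [LHS]tdotE !big_seq1. Qed.

End Tensor.

Section Fock.
Variables (C : numClosedFieldType) (H : preHilbertType C).

(* H^{\otimes 1} is H \otimes C, identified with H through x |-> x \otimes 1. *)
Fixpoint tpow (n : nat) : preHilbertType C :=
  if n is m.+1 then tens H (tpow m) else C^o.

(* tword [:: x_n; ...; x_1] is x_n \otimes ... \otimes x_1. *)
Fixpoint tword (s : seq H) : tpow (size s) :=
  if s is x :: s' then tpure x (tword s') else (1 : C).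

Definition fock : preHilbertType C := dsum tpow.

Definition fock_vac : fock := dsum_in (V := tpow) (n := 0) (1 : C).

Let lshift_fun (x : H) (X : fock) (n : nat) : tpow n :=
  if n is m.+1 then tpure x ((X : dsum tpow) m) else 0.

Let tpurex0 (V : preHilbertType C) (x : H) : tpure x (0 : V) = 0.
Proof. by apply: (addIr (tpure x 0)); rewrite -tpureDr addr0 add0r. Qed.

Let lshift_fin x X : `[< finsupp (lshift_fun x X) >].
Proof.
apply/asboolP; have [N XN] := dsum_bound (X : dsum tpow).
by exists N.+1 => -[|n] //= nN; rewrite XN // tpurex0.
Qed.

Definition lcreate (x : H) (X : fock) : fock := DSum (lshift_fin x X).

Lemma lcreate0 x X : (lcreate x X : dsum tpow) 0%N = 0.
Proof. by []. Qed.

Lemma lcreateS x X n :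
  (lcreate x X : dsum tpow) n.+1 = tpure x ((X : dsum tpow) n).
Proof. by []. Qed.

Let lcreate_lin x : linear (lcreate x).
Proof.
move=> c X Y; apply: dsumP => -[|n] /=; first by rewrite scaler0 addr0.
by rewrite tpureDr tpureZr.
Qed.
HB.instance Definition _ x :=
  GRing.isLinear.Build C fock fock *:%R (lcreate x) (lcreate_lin x).

End Fock.

Section Norms.
Variable R : realType.

Definition prenorm (V : preHilbertType R[i]) (v : V) : R :=
  Num.sqrt (complex.Re '[v, v]).

Definition bounded_op (V W : preHilbertType R[i]) (T : V -> W) : Prop :=
  exists M : R, forall v, prenorm (T v) <= M * prenorm v.

(* Only meaningful for bounded T: [sup] is 0 on unbounded sets. *)
Definition opnorm (V W : preHilbertType R[i]) (T : V -> W) : R :=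
  sup [set prenorm (T v) | v in [set v | prenorm v <= 1]].

End Norms.

Definition lspan (C : numClosedFieldType) (V : lmodType C) (A : set V) : set V :=
  [set v | exists (n : nat) (c : 'I_n -> C) (w : 'I_n -> V),
     (forall i, A (w i)) /\ v = \sum_i c i *: w i].

Record interactingFock (R : realType) (H : preHilbertType R[i]) := InteractingFock {
  ifs_level : nat -> preHilbertType R[i];
  ifs_vac : ifs_level 0;
  ifs_vac_unit : prenorm ifs_vac = 1;
  ifs_vac_total : forall v : ifs_level 0, exists c : R[i], v = c *: ifs_vac;
  ifs_creator : H -> {linear dsum ifs_level -> dsum ifs_level};
  ifs_creator_linear : forall (c : R[i]) (x y : H) (X : dsum ifs_level),
    ifs_creator (c *: x + y) X = c *: ifs_creator x X + ifs_creator y X;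
  ifs_creator_total : forall n : nat,
    lspan [set ifs_creator x (dsum_in v) | x in [set: H] & v in [set: ifs_level n]]
    = range (@dsum_in _ ifs_level n.+1)
}.

Section InteractingFockTheory.
Variables (R : realType) (H : preHilbertType R[i]) (I : interactingFock H).

Definition ifs_space : preHilbertType R[i] := dsum (ifs_level I).

Definition ifs_Omega : ifs_space := dsum_in (ifs_vac I).

Definition creator_bounded : Prop :=
  (forall x : H, bounded_op (ifs_creator I x)) /\
  exists M : R, forall x : H, opnorm (ifs_creator I x) <= M * prenorm x.

(* The restriction of Lambda to H^{\otimes n}. *)
Fixpoint Lambda_level (n : nat) : tpow H n -> ifs_space :=
  if n is m.+1 then tens_lift (fun x Y => ifs_creator I x (Lambda_level (n := m) Y))
  else fun c : R[i] => c *: ifs_Omega.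

Definition Lambda (X : fock H) : ifs_space :=
  \sum_(n \in [set: nat]) Lambda_level ((X : dsum (tpow H)) n).

Let creator_lin x : linear (ifs_creator I x). Proof. exact: linearP. Qed.

Lemma Lambda_level_linear n : linear (@Lambda_level n).
Proof.
elim: n => [|n IH] c X Y /=; first by rewrite scalerDl scalerA.
apply: tens_lift_linear => [Z d x y|x d Z T]; first exact: ifs_creator_linear.
by rewrite IH creator_lin.
Qed.

Lemma Lambda_levelS n x (X : tpow H n) :
  Lambda_level (n := n.+1) (tpure x X) = ifs_creator I x (Lambda_level X).
Proof.
apply: tens_liftE => [Z d u v|u d Z T]; first exact: ifs_creator_linear.
rewrite -creator_lin; congr (ifs_creator I u _).
exact: Lambda_level_linear.
Qed.

Let Lambda_level0 n : Lambda_level (0 : tpow H n) = 0.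
Proof.
have := Lambda_level_linear (-1) (0 : tpow H n) 0.
by rewrite scaler0 addr0 scaleN1r addNr.
Qed.

Lemma Lambda_linear : linear Lambda.
Proof.
move=> c X Y; have [N XN] := dsum_bound (X : dsum (tpow H)).
have [M YM] := dsum_bound (Y : dsum (tpow H)).
have XK n : (maxn N M <= n)%N -> (X : dsum (tpow H)) n = 0.
  by rewrite geq_max => /andP[/XN].
have YK n : (maxn N M <= n)%N -> (Y : dsum (tpow H)) n = 0.
  by rewrite geq_max => /andP[_ /YM].
rewrite /Lambda !(@fsum_ord _ _ (maxn N M)).
- rewrite scaler_sumr -big_split; apply: eq_bigr => n _ /=.
  exact: Lambda_level_linear.
- by move=> n /YK->.
- by move=> n /XK->.
- by move=> n nK; rewrite dsumDE dsumZE XK // YK // scaler0 addr0.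
Qed.
HB.instance Definition _ :=
  GRing.isLinear.Build R[i] (fock H) ifs_space *:%R Lambda Lambda_linear.

Let Lambda_in n (X : tpow H n) :
  Lambda (dsum_in X : dsum (tpow H)) = Lambda_level X.
Proof.
rewrite /Lambda (@fsum_ord _ _ n.+1) => [|m nm]; last first.
  rewrite /= dfwithout // ltn_eqF //.
rewrite big_ord_recr /= dfwithin big1 ?add0r // => m _.
by rewrite dfwithout // gtn_eqF.
Qed.

Lemma Lambda_vac : Lambda (fock_vac H) = ifs_Omega.
Proof. by rewrite /fock_vac Lambda_in /= scale1r. Qed.

Lemma Lambda_word (s : seq H) :
  Lambda (dsum_in (tword s) : dsum (tpow H)) =
  foldr (fun x (X : ifs_space) => ifs_creator I x X) ifs_Omega s.
Proof.
rewrite Lambda_in; elim: s => [|x s IH]; first by rewrite /= scale1r.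
by rewrite [LHS]Lambda_levelS IH.
Qed.

End InteractingFockTheory.

(* Main.v *)
Require Import Defs.
From mathcomp Require Import all_boot all_order all_algebra complex reals.
From mathcomp Require Import sesquilinear all_classical.

(** The theorem rests on two facts about the canonical map [Lambda] from the
full Fock space onto an interacting one.

First, [Lambda] intertwines the creation operators: [Lambda (lcreate x X)] is
[ifs_creator I x (Lambda X)] ([Lambda_lcreate]), by the recursive definition
of [Lambda] on tensor powers.  Second, [Lambda] is onto ([Lambda_surj]): its
range is a subspace that contains the vacuum and, by the intertwining relation,
is stable under every creator, whereas the totality axioms say that the vacuum
and the creators generate all levels.

Hence an estimate on [Lambda (lcreate x X)] in terms of [Lambda X], for all
[X], is the same thing as the estimate on [ifs_creator I x Z] in terms of [Z],
for all [Z].  This is part 1.  For part 2 such an estimate with a constant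
proportional to [prenorm x] has to be compared with one on [opnorm], which is
the usual homogeneity argument ([prenorm_le_opnorm], [opnorm_le]). *)

Set Implicit Arguments.
Unset Strict Implicit.
Unset Printing Implicit Defensive.

Import Order.TTheory GRing.Theory Num.Theory.

Local Open Scope classical_set_scope.
Local Open Scope ring_scope.

Section DirectSumTheory.
Variables (C : numClosedFieldType) (V : nat -> preHilbertType C).

Lemma dsum_inZ n (c : C) (v : V n) : dsum_in (c *: v) = c *: dsum_in v.
Proof.
apply: dsumP => m; rewrite dsumZE /=.
have [nm|nm] := eqVneq n m; first by subst m; rewrite !dfwithin.
by rewrite !dfwithout ?scaler0.
Qed.

Lemma dsum_in_sum (X : dsum V) N : (forall n, (N <= n)%N -> X n = 0) ->
  X = \sum_(n < N) dsum_in (X n).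
Proof.
move=> XN; apply: dsumP => m.
have -> : (\sum_(n < N) dsum_in (X n)) m = \sum_(n < N) dsum_in (X n) m.
  exact: (big_morph (fun Y : dsum V => Y m) (fun _ _ => erefl) erefl).
have [mN|Nm] := ltnP m N.
  rewrite (bigD1 (Ordinal mN)) //= dfwithin big1 ?addr0 // => n nm.
  by rewrite dfwithout.
rewrite XN // big1 // => n _; rewrite /= dfwithout //.
by rewrite ltn_eqF // (leq_trans (ltn_ord n)).
Qed.

End DirectSumTheory.

Section LambdaTheory.
Variables (R : realType) (H : preHilbertType R[i]) (I : interactingFock H).

(** [lcreate] shifts degrees by one, so its degree 0 component drops out of the
sum over degrees and each of the others is a pure tensor [tpure x (X n)]. *)
Lemma Lambda_lcreate x (X : fock H) :
  Lambda I (lcreate x X) = ifs_creator I x (Lambda I X).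
Proof.
have [N XN] := dsum_bound (X : dsum (tpow H)).
have L0 n : Lambda_level I (0 : tpow H n) = 0.
  have := Lambda_level_linear I (-1) (0 : tpow H n) 0.
  by rewrite scaler0 addr0 scaleN1r addNr.
rewrite /Lambda [X in _ = _ X](@fsum_ord _ _ N) => [|n /XN-> //].
rewrite (@fsum_ord _ _ N.+1) => [|[|n] // nN]; last first.
  by rewrite lcreateS Lambda_levelS XN // L0 linear0.
rewrite big_ord_recl lcreate0 L0 add0r linear_sum.
by apply: eq_bigr => n _; rewrite lcreateS Lambda_levelS.
Qed.

(** Induction on the degree: level 0 is spanned by the vacuum, and level [n.+1]
by creators applied to level [n], which are again in the range since a creator
acts on the range of [Lambda] through [lcreate]. *)
Lemma dsum_in_range_Lambda n (v : ifs_level I n) :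
  exists X, dsum_in v = Lambda I X.
Proof.
elim: n v => [|n IH] v.
  have [c ->] := ifs_vac_total v; exists (c *: fock_vac H).
  by rewrite [RHS]linearZ_LR /= Lambda_vac dsum_inZ.
have [k [c [w [wE ->]]]] :
    lspan [set ifs_creator I x (dsum_in u) |
            x in [set: H] & u in [set: ifs_level I n]] (dsum_in v).
  by rewrite ifs_creator_total; exists v.
have /choice[Y YE] : forall i, exists Y, w i = Lambda I Y.
  move=> i; have [x _ [u _ <-]] := wE i; have [Z ->] := IH u.
  by exists (lcreate x Z); rewrite Lambda_lcreate.
exists (\sum_i c i *: Y i); rewrite linear_sum.
by apply: eq_bigr => i _; rewrite linearZ_LR /= -YE.
Qed.

Lemma Lambda_surj (Z : ifs_space I) : exists X, Z = Lambda I X.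
Proof.
have [N ZN] := dsum_bound (Z : dsum (ifs_level I)).
have /choice[Y YE] :=
  fun n => dsum_in_range_Lambda ((Z : dsum (ifs_level I)) n).
exists (\sum_(n < N) Y n); rewrite linear_sum [LHS](dsum_in_sum ZN).
by apply: eq_bigr => n _; rewrite YE.
Qed.

(** Both parts of the theorem are instances of this transfer, with [K] a
constant [M] and [M * prenorm x] respectively. *)
Lemma creator_le_Lambda x (K : R) :
  (forall Z, prenorm (ifs_creator I x Z) <= K * prenorm Z) <->
  (forall X, prenorm (Lambda I (lcreate x X)) <= K * prenorm (Lambda I X)).
Proof.
split=> [le_creator X|le_Lambda Z]; first by rewrite Lambda_lcreate.
by have [X ->] := Lambda_surj Z; rewrite -Lambda_lcreate.
Qed.

End LambdaTheory.

Section NormTheory.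
Variables (R : realType) (V : preHilbertType R[i]).

Lemma prenorm_ge0 (v : V) : 0 <= prenorm v.
Proof. exact: sqrtr_ge0. Qed.

Lemma prenorm0 : prenorm (0 : V) = 0.
Proof. by rewrite /prenorm linear0l sqrtr0. Qed.

Lemma prenorm_eq0 (v : V) : prenorm v = 0 -> v = 0.
Proof.
move=> /eqP; rewrite sqrtr_eq0 => v0; apply/eqP; rewrite -(dnorm_eq0 (@hdot _ V)).
have := dnorm_ge0 (@hdot _ V) v.
case: '[v, v] v0 => a b /= a0; rewrite lecE /= => /andP[/eqP-> ge_a].
by rewrite eq_complex /= eqxx andbT eq_le a0.
Qed.

Lemma prenormZ (r : R) (v : V) : 0 <= r -> prenorm (r%:C *: v)%C = r * prenorm v.
Proof.
move=> r0; rewrite /prenorm linearZl_LR linearZr_LR /=.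
case: '[v, v] => a b /=.
rewrite oppr0 !(mul0r, mulr0, subr0, addr0, oppr0, sub0r) mulrA -expr2.
by rewrite sqrtrM ?sqr_ge0 // sqrtr_sqr ger0_norm.
Qed.

End NormTheory.

Section OpNormTheory.
Variables (R : realType) (V W : preHilbertType R[i]) (T : {linear V -> W}).

Lemma opnorm_le (K : R) : 0 <= K ->
  (forall v, prenorm (T v) <= K * prenorm v) -> opnorm T <= K.
Proof.
move=> K0 TK; apply: ge_sup.
  by exists (prenorm (T 0)), 0 => //=; rewrite prenorm0.
move=> _ [v /= v1 <-]; apply: (le_trans (TK v)).
by rewrite -[leRHS]mulr1 ler_wpM2l.
Qed.

(** Boundedness of [T] is what makes the supremum in [opnorm] an upper bound; the
estimate on the unit ball then extends to [v] by normalizing it, which is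
possible unless [prenorm v = 0], that is [v = 0]. *)
Lemma prenorm_le_opnorm v :
  bounded_op T -> prenorm (T v) <= opnorm T * prenorm v.
Proof.
move=> [M TM]; have [v0|v0] := eqVneq (prenorm v) 0.
  by rewrite v0 mulr0 (prenorm_eq0 v0) linear0 prenorm0.
have v_gt0 : 0 < prenorm v by rewrite lt_def v0 prenorm_ge0.
have r0 : 0 <= (prenorm v)^-1 by rewrite invr_ge0 ltW.
rewrite -ler_pdivrMr // mulrC -prenormZ // -linearZ_LR.
apply: ub_le_sup; last first.
  by exists ((prenorm v)^-1%:C *: v)%C => //=; rewrite prenormZ // mulVf.
(* M is nonnegative because v is nonzero; taking |M| saves the derivation. *)
exists `|M| => _ [w /= w1 <-]; apply: (le_trans (TM w)).
apply: (@le_trans _ _ (`|M| * prenorm w)).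
  by rewrite ler_wpM2r ?prenorm_ge0 ?ler_norm.
by rewrite -[leRHS]mulr1 ler_wpM2l.
Qed.

End OpNormTheory.

Theorem corollary6p5 (R : realType) (H : preHilbertType R[i])
    (I : interactingFock H) :
  (forall x : H,
     bounded_op (ifs_creator I x) <->
     exists M : R, forall X : fock H,
       prenorm (Lambda I (lcreate x X)) <= M * prenorm (Lambda I X)) /\
  (creator_bounded I <->
     exists M : R, forall (x : H) (X : fock H),
       prenorm (Lambda I (lcreate x X)) <=
         M * prenorm x * prenorm (Lambda I X)).
Proof.
split=> [x|]; first by split=> -[M /creator_le_Lambda leM]; exists M.
split=> [[bdI [M leM]]|[M leM]].
  exists M => x; apply/creator_le_Lambda => Z.
  apply: (le_trans (prenorm_le_opnorm Z (bdI x))).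
  by rewrite ler_wpM2r ?prenorm_ge0.
split=> [x|].
  by exists (M * prenorm x); apply/creator_le_Lambda/leM.
(* M may be negative when H = 0, and a supremum over the unit ball is bounded
   by K only for K nonnegative; hence the absolute value. *)
exists `|M| => x; apply: opnorm_le => [|Z].
  by rewrite mulr_ge0 ?prenorm_ge0.
apply: (@le_trans _ _ (M * prenorm x * prenorm Z)).
  by move: Z; apply/creator_le_Lambda/leM.
by rewrite !ler_wpM2r ?prenorm_ge0 ?ler_norm.
Qed.
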